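(* Let $\Bbbk$ be a field, let $d\ge 1$ be an integer, and let $I=(x^{2d+1},x^{2d-1}y^2,y^{2d+1}z)\subseteq A=\Bbbk[x,y,z]$. Then the following statements hold. (1) For each $1\le n\le d$, $I^{(n)}=I^n$. (2) For each $n\ge d+1$, there is a chain $$I^{(n)}=I^n+(x^dy)^{2d+1}I^{n-d-1}\subseteq I^{n-1}.$$ In particular, $\rho(I)=1$. Moreover, $(x^dy)^{2d+1}\in I^{(d+1)}\setminus I^{d+1}$.
   Context: Convention: $I^0=A$. For an ideal $I$ of a noetherian ring $A$ and $n\ge 1$, the $n$-th symbolic power (defined via associated primes) is $I^{(n)}=\bigcap_{\mathfrak p\in \operatorname{Ass}(I)}(I^nA_{\mathfrak p}\cap A)$, where $\operatorname{Ass}(I)$ is the set of associated primes of $A/I$ and $I^nA_{\mathfrak p}\cap A$ is the preimage of $I^nA_{\mathfrak p}$ in $A$. The resurgence of a nonzero proper homogeneous ideal $I$ in a polynomial ring (variables of degree 1) is $\rho(I)=\sup\{\frac{m}{r}: I^{(m)}\not\subseteq I^r,\ m\ge 1,\ r\ge 1\}$ ($m,r$ integers). *)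

(* Defs.v *)
From HB Require Import structures.
From mathcomp Require Import all_boot all_order all_algebra ring_quotient.
From mathcomp Require Import all_classical all_reals ereal.
(* The notations of mpoly clash with those of MathComp-Analysis. *)
From mathcomp Require Import -(notations) mpoly.

Set Implicit Arguments.
Unset Strict Implicit.
Unset Printing Implicit Defensive.

Import Order.TTheory GRing.Theory Num.Theory.

Local Open Scope classical_set_scope.
Local Open Scope ring_scope.

(* [ideal_of B J]: J is an ideal, possibly improper, of the subring B of A. The
   subring B is needed for ideals of a localization inside the fraction field. *)
Definition ideal_of (A : comNzRingType) (B J : set A) : Prop :=
  [/\ J `<=` B, J 0,
      forall u v, J u -> J v -> J (u + v)
    & forall b u, B b -> J u -> J (b * u)].

Definition gen_ideal_of (A : comNzRingType) (B G : set A) : set A :=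
  smallest (ideal_of B) G.

Definition gen_ideal (A : comNzRingType) (G : set A) : set A :=
  gen_ideal_of [set: A] G.

Definition ideal_add (A : comNzRingType) (I J : set A) : set A :=
  [set a + b | a in I & b in J].

Definition ideal_mul (A : comNzRingType) (I J : set A) : set A :=
  gen_ideal [set a * b | a in I & b in J].

Definition ideal_pow (A : comNzRingType) (I : set A) (n : nat) : set A :=
  iter n (ideal_mul I) [set: A].

Definition ideal_scale (A : comNzRingType) (f : A) (I : set A) : set A :=
  [set f * a | a in I].

(* [idealr_closed] entails that p is proper. *)
Definition prime_ideal_set (A : comNzRingType) (p : set A) : Prop :=
  idealr_closed [in p] /\ prime_idealr_closed [in p].

(* The prime ideals that are annihilators of elements of A / I: the annihilator
   of the class of a is [set b | I (b * a)]. *)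
Definition Ass (A : comNzRingType) (I : set A) : set (set A) :=
  [set p | prime_ideal_set p /\ exists a : A, p = [set b | I (b * a)]].

(* For a prime ideal p of a domain A: the localization A_p, as a subring of the
   fraction field of A. *)
Definition localization (A : idomainType) (p : set A) : set {fraction A} :=
  [set tofrac a / tofrac s | a in [set: A] & s in ~` p].

Definition extension (A : idomainType) (p J : set A) : set {fraction A} :=
  gen_ideal_of (localization p) (@tofrac A @` J).

Definition symb_pow (A : idomainType) (I : set A) (n : nat) : set A :=
  \bigcap_(p in Ass I) (@tofrac A @^-1` extension p (ideal_pow I n)).

Definition resurgence (R : realType) (A : idomainType) (I : set A) : \bar R :=
  ereal_sup [set q : \bar R | exists m r : nat,
    [/\ (1 <= m)%N, (1 <= r)%N, ~ (symb_pow I m `<=` ideal_pow I r)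
      & q = (m%:R / r%:R)%:E]].

Section ThreeVariables.
Variable k : fieldType.

Definition x : mpoly 3 k := mpolyX k (mnm1 (inord 0)).
Definition y : mpoly 3 k := mpolyX k (mnm1 (inord 1)).
Definition z : mpoly 3 k := mpolyX k (mnm1 (inord 2)).

Definition example_ideal (d : nat) : set (mpoly 3 k) :=
  gen_ideal [set x ^+ (2 * d + 1);
                 x ^+ (2 * d - 1) * y ^+ 2;
                 y ^+ (2 * d + 1) * z].

End ThreeVariables.

Arguments example_ideal k d : clear implicits.

(* Main.v *)
Require Import Defs.
From HB Require Import structures.
From mathcomp Require Import all_boot all_order all_algebra.
From mathcomp Require Import all_classical all_reals ereal.
From mathcomp Require Import -(notations) mpoly.
From mathcomp Require Import zify.

(** The ideal I and its powers are monomial, so membership in them is a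
    condition on exponents, checked on each monomial of a polynomial. The
    monomial x^a y^b z^c lies in I^n when n = i + j + l with
      (2d+1)i + (2d-1)j <= a,   2j + (2d+1)l <= b,   l <= c   ([expI]).

    The associated primes of I are (x,y) and (x,z). Only the following is
    needed: both are associated ([Ass_xy], [Ass_xz], as annihilators of
    explicit monomials), and every associated prime misses y or z
    ([Ass_misses_y_or_z]), since ya, za in I imply a in I. Inverting z turns
    I into J = (x^{2d+1}, x^{2d-1}y^2, y^{2d+1}), and inverting y turns it into
    K = (x^{2d-1}, z). Powers of J and K are generated by monomials in the
    variables that are not inverted, so they are saturated
    ([monomial_ideal_saturated]), and I^(n) is the intersection of J^n and K^n
    ([symb_pow_monomial]).

    It remains to compare exponents ([expJ_expK_split]). Given a monomial of
    both J^n and K^n, take a representation n = i + j + l for J^n with l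
    minimal. If l <= c the monomial is in I^n. Otherwise each of three exchanges
    lowering l would contradict minimality, unless i >= d, a equals
    (2d+1)i + (2d-1)j, and l = c + 1; then (x^d y)^{2d+1} =
    (x^{2d+1})^d y^{2d+1} splits off, and the quotient is a monomial of
    I^{n-d-1}.

    Finally (x^d y)^{2d+1} is in I^d, whence I^(n) is contained in I^{n-1}
    for all n >= 1. So m/r <= 1 whenever I^(m) is not contained in I^r, and
    the element (x^d y)^{2d+1} shows that m = r = d + 1 attains the value 1. *)

Set Implicit Arguments.
Unset Strict Implicit.
Unset Printing Implicit Defensive.

Import Order.TTheory GRing.Theory Num.Theory.

(** * Exponents of the monomials of the powers of I, J and K *)

(** x^a y^b z^c lies in I^n: it is divisible by a product of [i], [j] and [l]
    copies of the three generators. *)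
Definition expI (d n a b c : nat) : Prop := exists i j l,
  [/\ i + j + l = n, (2 * d + 1) * i + (2 * d - 1) * j <= a,
      2 * j + (2 * d + 1) * l <= b & l <= c].

(** x^a y^b lies in J^n, where J = (x^{2d+1}, x^{2d-1}y^2, y^{2d+1}). *)
Definition expJ (d n a b : nat) : Prop := exists i j l,
  [/\ i + j + l = n, (2 * d + 1) * i + (2 * d - 1) * j <= a
    & 2 * j + (2 * d + 1) * l <= b].

(** x^a z^c lies in K^n, where K = (x^{2d-1}, z). The exponent [e] of x^{2d-1}
    may exceed [n]. *)
Definition expK (d n a c : nat) : Prop :=
  exists e, (2 * d - 1) * e <= a /\ n <= e + c.

Lemma expI_expJ d n a b c : expI d n a b c -> expJ d n a b.
Proof. by move=> [i [j [l [? ? ? _]]]]; exists i, j, l. Qed.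

Lemma expI_expK d n a b c : expI d n a b c -> expK d n a c.
Proof. by move=> [i [j [l [? ? ? ?]]]]; exists (i + j); split; nia. Qed.

(** z^n J^n is contained in I^n. *)
Lemma expJ_shift d n a b : expJ d n a b -> expI d n a b n.
Proof. by move=> [i [j [l [? ? ?]]]]; exists i, j, l; split => //; lia. Qed.

(** With w = (x^d y)^{2d+1}: the ideal w I^{n-d-1} is contained in J^n and, by
    the next lemma, in K^n. *)
Lemma expI_w_expJ d n a b c : d < n -> expI d (n - d - 1) a b c ->
  expJ d n (d * (2 * d + 1) + a) (2 * d + 1 + b).
Proof.
move=> dn [i [j [l [? ? ? ?]]]]; exists (i + d), j, (l + 1).
by split; [lia|nia|nia].
Qed.

Lemma expI_w_expK d n a b c : d < n -> expI d (n - d - 1) a b c ->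
  expK d n (d * (2 * d + 1) + a) c.
Proof.
move=> dn [i [j [l [? ? ? ?]]]]; exists (i + j + d + 1).
split; last lia.
have le : (2 * d - 1) * (d + 1) <= d * (2 * d + 1).
  by have [->|d0] := posnP d; [|nia].
nia.
Qed.

(** y^{(2d+1)n} K^n is contained in I^n. *)
Lemma expK_shift d n a c : 0 < d -> expK d n a c -> expI d n a ((2 * d + 1) * n) c.
Proof.
move=> d0 [e [ea nec]]; have [en|ne] := leqP e n.
  by exists 0, e, (n - e); split; [lia|lia|nia|lia].
by exists 0, n, 0; split; [lia|nia|nia|lia].
Qed.

(** The combinatorial core: a monomial of both J^n and K^n is in I^n or in
    w I^{n-d-1}, where w = (x^d y)^{2d+1}. Strong induction on [l] replaces the
    choice of a representation with [l] minimal. *)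
Lemma expJ_expK_split d n a b c : 0 < d -> expJ d n a b -> expK d n a c ->
  expI d n a b c \/
  [/\ d < n, d * (2 * d + 1) <= a, 2 * d + 1 <= b
    & expI d (n - d - 1) (a - d * (2 * d + 1)) (b - (2 * d + 1)) c].
Proof.
move=> d0 [i [j [l H]]] [e [ea nec]].
elim/ltn_ind: l i j H => l IH i j [ijl ale ble].
have [lc|cl] := leqP l c; first by left; exists i, j, l.
have [B BE] : exists B, B = 2 * d - 1 by exists (2 * d - 1).
have AE : 2 * d + 1 = B + 2 by lia.
have dE : 2 * d = B + 1 by lia.
rewrite AE -BE in ea ale ble IH *.
(* From K^n: after replacing l - c copies of y^{2d+1} by as many of
   x^{2d-1}, and every x^{2d+1} by x^{2d-1}, the exponent of x still fits. *)
have KB : B * (i + j + (l - c)) <= a by nia.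
(* First exchange: y^{2d+1} (x^{2d+1})^i becomes (x^{2d-1}y^2)^{i+1}. *)
have [id|di] := ltnP i d.
  by apply: (IH l.-1 _ 0 (i + j + 1)); [lia|split; [lia|nia|nia]].
have [q iE] : exists q, i = q + d by exists (i - d); lia.
(* Second exchange: y^{2d+1} (x^{2d+1})^{d-1} becomes (x^{2d-1}y^2)^d, which
   costs a single factor x. *)
have [lt|ge] := ltnP ((B + 2) * i + B * j) a.
  apply: (IH l.-1 _ (i - d.-1) (j + d)); first lia.
  have -> : i - d.-1 = q + 1 by lia.
  by split; [lia|nia|nia].
(* Third exchange, at no cost: (y^{2d+1})^2 (x^{2d+1})^{2d-1} is equal to
   (x^{2d-1}y^2)^{2d+1}. *)
have [l2|l1] := leqP (c + 2) l.
  have Bi : B <= i by nia.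
  apply: (IH l.-2 _ (i - B) (j + B + 2)); first lia.
  have [r rE] : exists r, i = r + B by exists (i - B); lia.
  have -> : i - B = r by lia.
  by split; [lia|nia|nia].
right; split; [lia|nia|nia|].
by exists q, j, l.-1; split; rewrite ?AE -?BE; [lia|nia|nia|lia].
Qed.

(** The monomial (x^d y)^{2d+1} is in I^d and, by the next lemma, not in
    I^{d+1}. *)
Lemma expI_w d : 0 < d -> expI d d (d * (2 * d + 1)) (2 * d + 1) 0.
Proof. by move=> d0; exists d, 0, 0; split; nia. Qed.

Lemma expI_w_not d : ~ expI d (d + 1) (d * (2 * d + 1)) (2 * d + 1) 0.
Proof.
move=> [i [j [l [ijl ale ble l0]]]].
have lE : l = 0 by lia.
subst l; have jd : j <= d by nia.
have iE : i = d + 1 - j by lia.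
subst i; nia.
Qed.

Lemma expI_add d m n a b c a' b' c' : expI d m a b c -> expI d n a' b' c' ->
  expI d (m + n) (a + a') (b + b') (c + c').
Proof.
move=> [i [j [l [? ? ? ?]]]] [i' [j' [l' [? ? ? ?]]]].
by exists (i + i'), (j + j'), (l + l'); split; nia.
Qed.

Lemma expI_mono d n a b c a' b' c' : a <= a' -> b <= b' -> c <= c' ->
  expI d n a b c -> expI d n a' b' c'.
Proof.
by move=> ? ? ? [i [j [l [? ? ? ?]]]]; exists i, j, l; split; lia.
Qed.

Lemma expI1 d a b c : expI d 1 a b c <->
  [\/ 2 * d + 1 <= a, 2 * d - 1 <= a /\ 2 <= b | 2 * d + 1 <= b /\ 1 <= c].
Proof.
split=> [[i [j [l [ijl ? ? ?]]]]|].
  have [] : (i = 1 /\ j = 0 /\ l = 0) \/ (i = 0 /\ j = 1 /\ l = 0) \/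
    (i = 0 /\ j = 0 /\ l = 1) by lia.
    by move=> [? [? ?]]; subst; apply: Or31; lia.
  by move=> [] [? [? ?]]; subst; [apply: Or32|apply: Or33]; lia.
move=> [?|[? ?]|[? ?]].
- by exists 1, 0, 0; split; lia.
- by exists 0, 1, 0; split; lia.
- by exists 0, 0, 1; split; lia.
Qed.

Local Open Scope classical_set_scope.
Local Open Scope ring_scope.

(** * Ideals, localization and symbolic powers *)

Lemma ideal_of_smallest (A : comNzRingType) (B G : set A) :
  G `<=` B -> ideal_of B B -> ideal_of B (gen_ideal_of B G).
Proof.
move=> GB BB; split.
- exact: smallest_sub.
- by move=> L [[]].
- by move=> u v Gu Gv L [IL GL]; case: (IL) => _ _ LD _; apply: LD;
    [apply: Gu | apply: Gv].
- by move=> b u Bb Gu L [IL GL]; case: (IL) => _ _ _ LM; apply: LM => //; apply: Gu.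
Qed.

Lemma ideal_ofT (A : comNzRingType) : ideal_of [set: A] [set: A].
Proof. by split. Qed.

Lemma gen_ideal_ideal (A : comNzRingType) (G : set A) :
  ideal_of [set: A] (gen_ideal G).
Proof. by apply: ideal_of_smallest => //; apply: ideal_ofT. Qed.

Lemma ideal_pow_ideal (A : comNzRingType) (I : set A) n :
  ideal_of [set: A] (ideal_pow I n).
Proof. by case: n => [|n]; [apply: ideal_ofT | apply: gen_ideal_ideal]. Qed.

Lemma ideal_of_colon (A : comNzRingType) (J : set A) (s : A) :
  ideal_of [set: A] J -> ideal_of [set: A] [set f | J (s * f)].
Proof.
move=> [_ J0 JD JM]; split => //=; first by rewrite mulr0.
- by move=> u v Ju Jv; rewrite mulrDr; apply: JD.
- by move=> b u _ Ju; rewrite mulrCA; apply: JM.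
Qed.

Lemma prime_notin_exp (A : comNzRingType) (p : set A) (s : A) n :
  prime_ideal_set p -> ~ p s -> ~ p (s ^+ n).
Proof.
move=> [[_ p1 _] pM] ps; elim: n => [|n IHn].
  by rewrite expr0 => /mem_set; apply/negP.
by rewrite exprS => /mem_set /pM /orP [] /set_mem.
Qed.

Section Localization.
Variables (A : idomainType) (p : set A).
Hypothesis p_prime : prime_ideal_set p.

Let p_notin0 s : ~ p s -> s != 0.
Proof. by move=> ps; apply: contra_notN ps => /eqP ->; case: p_prime => [[/set_mem]]. Qed.

Let p_notinM s t : ~ p s -> ~ p t -> ~ p (s * t).
Proof. by move=> ps pt; case: p_prime => _ pM /mem_set /pM /orP [] /set_mem. Qed.

(** J A_p meets A in the saturation of J by the complement of p. *)
Lemma extensionP (J : set A) (f : A) : ideal_of [set: A] J ->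
  extension p J (tofrac f) <-> exists2 s, ~ p s & J (s * f).
Proof.
have p1 : ~ p 1 by case: p_prime => [[_ /negP p1 _] _] /mem_set.
move=> [_ J0 JD JM]; split; last first.
  move=> [s ps Jsf] L [[_ _ _ LM] JL].
  have -> : tofrac f = (tofrac 1 / tofrac s) * tofrac (s * f).
    rewrite tofracM mulrA tofrac1 mul1r mulVf ?mul1r //.
    by rewrite tofrac_eq0 p_notin0.
  by apply: LM; [exists 1 => //; exists s | apply: JL; exists (s * f)].
(* The fractions g / t with g in J and t not in p already form an ideal of the
   localization. *)
pose L : set {fraction A} :=
  [set u | exists g t, [/\ J g, ~ p t & u = tofrac g / tofrac t]].
have IL : ideal_of (localization p) L.
  split.
  - by move=> u [g [t [Jg pt ->]]]; exists g => //; exists t.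
  - by exists 0, 1; split => //; rewrite tofrac0 mul0r.
  - move=> u v [g [t [Jg pt ->]]] [h [w [Jh pw ->]]].
    exists (w * g + t * h), (t * w); split; [|exact: p_notinM|].
      by apply: JD; apply: JM.
    rewrite addf_div ?tofrac_eq0 ?p_notin0 // tofracD !tofracM.
    by rewrite [tofrac w * _]mulrC [tofrac t * tofrac h]mulrC.
  - move=> b u [a _ [r pr <-]] [g [t [Jg pt ->]]].
    exists (a * g), (r * t); split; [exact: JM|exact: p_notinM|].
    by rewrite mulf_div !tofracM.
have JL : @tofrac A @` J `<=` L.
  by move=> _ [g Jg <-]; exists g, 1; split => //; rewrite tofrac1 divr1.
move=> /(smallest_sub IL JL) [g [t [Jg pt fE]]].
exists t => //; suff -> : t * f = g by [].
apply/eqP; rewrite -tofrac_eq tofracM fE mulrC divfK //.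
by rewrite tofrac_eq0 p_notin0.
Qed.

End Localization.

Lemma symb_powP (A : idomainType) (I : set A) n (f : A) :
  symb_pow I n f <->
  forall p, Ass I p -> exists2 s, ~ p s & ideal_pow I n (s * f).
Proof.
split=> H p Ap; have [pP _] := Ap.
  by apply/(extensionP pP); [apply: ideal_pow_ideal | apply: H].
by apply/(extensionP pP); [apply: ideal_pow_ideal | apply: H].
Qed.

Lemma ideal_pow_sub_symb_pow (A : idomainType) (I : set A) n :
  ideal_pow I n `<=` symb_pow I n.
Proof.
move=> f If; apply/symb_powP => p [[[_ /negP p1 _] _] _].
by exists 1; rewrite ?mul1r // => /mem_set.
Qed.

Lemma ideal_pow_anti (A : comNzRingType) (I : set A) m n :
  (m <= n)%N -> ideal_pow I n `<=` ideal_pow I m.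
Proof.
move=> /subnK <-; elim: (n - m)%N => [//|j IHj].
rewrite addSn /ideal_pow iterS -!/(ideal_pow I _).
apply: subset_trans IHj.
apply: smallest_sub; first exact: ideal_pow_ideal.
move=> _ [a _ [b Ib <-]].
by have [_ _ _ M] := ideal_pow_ideal I (j + m); apply: M.
Qed.

Lemma ideal_add_ideal (A : comNzRingType) (I J : set A) :
  ideal_of [set: A] I -> ideal_of [set: A] J -> ideal_of [set: A] (ideal_add I J).
Proof.
move=> [_ I0 ID IM] [_ J0 JD JM]; split => //.
- by exists 0 => //; exists 0; rewrite ?addr0.
- move=> _ _ [a Ia [b Jb <-]] [a' Ia' [b' Jb' <-]].
  by exists (a + a'); [apply: ID|exists (b + b'); [apply: JD|rewrite addrACA]].
- move=> c _ _ [a Ia [b Jb <-]].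
  by exists (c * a); [apply: IM|exists (c * b); [apply: JM|rewrite mulrDr]].
Qed.

Lemma ideal_scale_ideal (A : comNzRingType) (f : A) (I : set A) :
  ideal_of [set: A] I -> ideal_of [set: A] (ideal_scale f I).
Proof.
move=> [_ I0 ID IM]; split => //.
- by exists 0; rewrite ?mulr0.
- by move=> _ _ [a Ia <-] [b Ib <-]; exists (a + b); [apply: ID|rewrite mulrDr].
- by move=> c _ _ [a Ia <-]; exists (c * a); [apply: IM|rewrite mulrCA].
Qed.

(** * Monomial ideals *)

Lemma seq_argmin (d : Order.disp_t) (U : orderType d) (T : eqType) (f : T -> U)
    (s : seq T) (x0 : T) : x0 \in s ->
  exists2 a, a \in s & forall b, b \in s -> (f a <= f b)%O.
Proof.
elim: s x0 => [//|c s IHs] x0 _.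
case: s IHs => [_|e s IHs].
  by exists c; rewrite ?mem_head // => b; rewrite inE => /eqP ->.
have [a ain amin] := IHs e (mem_head _ _).
have [cle|alt] := leP (f c) (f a).
  exists c; rewrite ?mem_head // => b; rewrite inE => /predU1P [-> //|/amin].
  exact: le_trans.
exists a; first by rewrite inE ain orbT.
by move=> b; rewrite inE => /predU1P [->|/amin //]; apply: ltW.
Qed.

Section MonomialIdeals.
Variables (n : nat) (R : idomainType).
Implicit Types (M N : set (multinom n)) (m : multinom n) (f g s : mpoly n R).

(** The polynomials all of whose monomials have exponents in M. It is an ideal
    as soon as M is closed upwards. *)
Definition monomial_ideal M : set (mpoly n R) :=
  [set f | forall m, m \in msupp f -> M m].

(** Multiplying a monomial with exponent in M by any monomial gives a monomial
    with exponent in M. *)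
Definition upclosed M := forall m m', M m -> M (mnm_add m m').

Lemma monomial_ideal_X M m : monomial_ideal M (mpolyX R m) <-> M m.
Proof.
split=> [|Mm m']; first by apply; rewrite msuppX mem_head.
by rewrite msuppX inE => /eqP ->.
Qed.

Lemma monomial_ideal_ideal M : upclosed M -> ideal_of [set: _] (monomial_ideal M).
Proof.
move=> upM; split=> //.
- by move=> m; rewrite msupp0.
- move=> f g Mf Mg m /msuppD_le; rewrite mem_cat => /orP [/Mf|/Mg]; exact.
- move=> f g _ Mg m /msuppM_le /allpairsP [[m1 m2] /= [_ /Mg Mm2 ->]].
  by rewrite addmC; apply: upM.
Qed.

Lemma monomial_ideal_sub M (L : set (mpoly n R)) : ideal_of [set: _] L ->
  (forall m, M m -> L (mpolyX R m)) -> monomial_ideal M `<=` L.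
Proof.
move=> [_ L0 LD LM] ML f Mf; rewrite (mpolyE f) big_seq.
apply: big_ind => // m /Mf /ML Lm.
by rewrite -mul_mpolyC; apply: LM.
Qed.

Lemma monomial_idealI M N :
  monomial_ideal (M `&` N) = monomial_ideal M `&` monomial_ideal N.
Proof.
apply/seteqP; split=> f; first by move=> MN; split=> m /MN [].
by move=> [Mf Nf] m mf; split; [apply: Mf|apply: Nf].
Qed.

Lemma monomial_ideal_mul M N : upclosed N ->
  ideal_mul (monomial_ideal M) (monomial_ideal N) =
  monomial_ideal [set mnm_add m1 m2 | m1 in M & m2 in N].
Proof.
move=> upN; apply/seteqP; split.
  apply: smallest_sub.
    apply: monomial_ideal_ideal => m m' [m1 Mm1 [m2 Nm2 <-]].
    by exists m1 => //; exists (mnm_add m2 m'); [apply: upN|rewrite addmA].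
  move=> _ [f Mf [g Ng <-]] m /msuppM_le /allpairsP [[m1 m2] /= [m1f m2g ->]].
  by exists m1; [apply: Mf|exists m2; [apply: Ng|]].
apply: monomial_ideal_sub; first exact: gen_ideal_ideal.
move=> _ [m1 Mm1 [m2 Nm2 <-]]; apply: sub_gen_smallest.
exists (mpolyX R m1); first exact/monomial_ideal_X.
by exists (mpolyX R m2); [exact/monomial_ideal_X|rewrite mpolyXD].
Qed.

Lemma monomial_ideal_mulX M f m :
  monomial_ideal M (f * mpolyX R m) <-> monomial_ideal [set u | M (mnm_add m u)] f.
Proof.
have E u : (u \in msupp (f * mpolyX R m)) = (u \in [seq mnm_add m m' | m' <- msupp f]).
  exact/perm_mem/msuppMX.
split=> Mf u; first by move=> uf; apply: Mf; rewrite E map_f.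
by rewrite E => /mapP [u' /Mf Mu' ->].
Qed.

(** The prime ideal generated by the variables with index in S. *)
Definition var_prime (S : pred 'I_n) : set (mpoly n R) :=
  monomial_ideal [set m | exists2 i, S i & (0 < m i)%N].

(** A monomial ideal generated by monomials in the variables of S is saturated
    with respect to the complement of the prime generated by S. Suppose that f
    has a monomial outside of M. Take such an m with its degree in S minimal
    and, next, m itself minimal in the monomial order; take also u minimal among
    the monomials of s not involving S. Then only the pair (u, m) contributes to
    the coefficient of u + m in s f, so u + m, and hence m, is in M. *)
Lemma monomial_ideal_saturated (S : pred 'I_n) M f s :
  (forall m m', (forall i, S i -> (m i <= m' i)%N) -> M m -> M m') ->
  ~ var_prime S s -> monomial_ideal M (s * f) -> monomial_ideal M f.
Proof.
move=> Mup /existsNP [u0 /not_implyP [u0s u0S]] Msf m0 m0f; apply: contrapT => Mm0.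
pose degS m := (\sum_(i < n | S i) m i)%N.
have m0L : m0 \in [seq m <- msupp f | ~~ `[<M m>]].
  by rewrite mem_filter m0f andbT; apply/asboolPn.
have [m1 + m1min] := seq_argmin degS m0L.
rewrite mem_filter => /andP [/asboolPn Mm1 m1f].
have m1L : m1 \in [seq m <- msupp f | ~~ `[<M m>] & degS m == degS m1].
  by rewrite mem_filter eqxx m1f !andbT; apply/asboolPn.
have [m + mmin] := seq_argmin (id : multinom n -> multinom n) m1L.
rewrite mem_filter => /andP [/andP [/asboolPn Mm /eqP degm] mf].
have u0L : u0 \in [seq u : multinom n <- msupp s | [forall i, S i ==> (u i == 0)%N]].
  rewrite mem_filter u0s andbT; apply/forallP => i; apply/implyP => Si.
  by rewrite -leqn0 leqNgt; apply/negP => u0i; apply: u0S; exists i.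
have [u + umin] := seq_argmin (id : multinom n -> multinom n) u0L.
rewrite mem_filter => /andP [/forallP uS us].
have {}uS i : S i -> u i = 0%N by move=> Si; have /implyP /(_ Si) /eqP := uS i.
have sfmu : mnm_add u m \in msupp (s * f).
  have ub : (mdeg u < (mdeg (mnm_add u m)).+1)%N by rewrite ltnS mdegD leq_addr.
  have mb : (mdeg m < (mdeg (mnm_add u m)).+1)%N by rewrite ltnS mdegD leq_addl.
  rewrite mcoeff_msupp mcoeffM (bigD1 (BMultinom ub, BMultinom mb)) //=.
  rewrite big1 ?addr0; first by rewrite mulf_neq0 // -mcoeff_msupp.
  move=> [[u' ub'] [m' mb']] /= /andP [/eqP uE neq].
  apply/eqP; rewrite mulf_eq0 -implyNb -mcoeff_msupp; apply/implyP => u's.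
  apply/negPn; rewrite -mcoeff_msupp; apply/negP => m'f.
  have em i : (u i + m i = u' i + m' i)%N by rewrite -!mnmDE uE.
  have m'le i : S i -> (m' i <= m i)%N.
    by move=> Si; rewrite -[m i]add0n -(uS i Si) em leq_addl.
  have Mm' : ~ M m' by move=> /(Mup _ _ m'le).
  have degle : (degS m1 <= degS m')%N.
    by apply: m1min; rewrite mem_filter m'f andbT; apply/asboolPn.
  have mS i : S i -> m' i = m i.
    have : degS m' == degS m.
      by rewrite eqn_leq {2}degm degle andbT; apply: leq_sum.
    have le j : S j -> (m' j <= m j ?= iff (m' j == m j))%N.
      by move=> /m'le; apply: leqif_eq.
    by rewrite (leqif_sum le).2 => /forallP /(_ i) /implyP H /H /eqP.
  have lem : (m <= m')%O.
    apply: mmin; rewrite mem_filter m'f andbT -degm; apply/andP; split.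
      exact/asboolPn.
    by apply/eqP/eq_bigr.
  have leu : (u <= u')%O.
    apply: umin; rewrite mem_filter u's andbT; apply/forallP => i.
    by apply/implyP => Si; rewrite -(eqn_add2r (m' i)) -em uS // mS.
  have mm' : m = m'.
    apply/eqP; rewrite eq_le lem leNgt; apply/negP => lt.
    by have := lemc_lt_add leu lt; rewrite uE ltxx.
  have uu' : u = u' by move: uE; rewrite mm' => /addIm.
  by move: neq; rewrite xpair_eqE !bmeqP /= uu' mm' !eqxx.
apply: Mm; apply: Mup (Msf _ sfmu) => i Si.
by rewrite mnmDE uS.
Qed.

End MonomialIdeals.

Arguments monomial_ideal {n} R M.
Arguments var_prime {n} R S.

Lemma var_prime_prime (n : nat) (R : idomainType) (S : pred 'I_n) :
  prime_ideal_set (var_prime R S).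
Proof.
have up : upclosed [set m : multinom n | exists2 i, S i & (0 < m i)%N].
  by move=> m m' [i Si mi]; exists i => //; rewrite mnmDE ltn_addr.
have [_ P0 PD PM] := monomial_ideal_ideal R up.
split; [split|].
- exact/mem_set.
- apply/negP => /set_mem /(_ (@mnm0 n)).
  by rewrite msupp1 mem_head => /(_ isT) [i _]; rewrite mnm0E.
- by move=> a u v /set_mem Pu /set_mem Pv; apply/mem_set/PD => //; apply: PM.
move=> u v /set_mem Puv; apply/orP.
have [Pu|Pu] := pselect (var_prime R S u); [left|right]; apply/mem_set => //.
apply: monomial_ideal_saturated Pu Puv => m m' le [i Si mi].
by exists i => //; apply: leq_trans mi (le i Si).
Qed.

(** * The ideal I and its powers *)

Section ThreeVariables.
Variable k : fieldType.

Local Notation ix := (@inord 2 0).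
Local Notation iy := (@inord 2 1).
Local Notation iz := (@inord 2 2).

(** The exponent of x^a y^b z^c. *)
Definition mon3 (a b c : nat) : multinom 3 := Multinom [tuple a; b; c].

Lemma mon3E a b c :
  (mon3 a b c ix = a) * (mon3 a b c iy = b) * (mon3 a b c iz = c).
Proof.
by split; [split|]; rewrite mnm_tnth (tnth_nth 0%N) /= inordK.
Qed.

Lemma I3P (i : 'I_3) : [\/ i = ix, i = iy | i = iz].
Proof.
case: i => [[|[|[|//]]] h]; [apply: Or31|apply: Or32|apply: Or33];
  by apply/val_inj; rewrite /= inordK.
Qed.

Lemma mpolyX_mon3 a b c : x k ^+ a * y k ^+ b * z k ^+ c = mpolyX k (mon3 a b c).
Proof.
rewrite /x /y /z !mpolyXn -!mpolyXD; congr (mpolyX k _); apply/mnmP => i.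
rewrite !mnmDE !mulmnE !mnm1E.
by case: (I3P i) => ->; rewrite mon3E -!val_eqE /= !inordK //=; lia.
Qed.

Lemma mpolyX_x a : x k ^+ a = mpolyX k (mon3 a 0 0).
Proof. by rewrite -mpolyX_mon3 !expr0 !mulr1. Qed.

Lemma mpolyX_y b : y k ^+ b = mpolyX k (mon3 0 b 0).
Proof. by rewrite -mpolyX_mon3 !expr0 mul1r mulr1. Qed.

Lemma mpolyX_z c : z k ^+ c = mpolyX k (mon3 0 0 c).
Proof. by rewrite -mpolyX_mon3 !expr0 !mul1r. Qed.

Variable d : nat.
Local Notation I := (example_ideal k d).

(** Exponents of the monomials of I^n, J^n and K^n. *)
Definition powI n : set (multinom 3) := [set m | expI d n (m ix) (m iy) (m iz)].
Definition powJ n : set (multinom 3) := [set m | expJ d n (m ix) (m iy)].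
Definition powK n : set (multinom 3) := [set m | expK d n (m ix) (m iz)].

Lemma upclosed_powI n : upclosed (powI n).
Proof. by move=> m m'; apply: expI_mono; rewrite mnmDE leq_addr. Qed.

Lemma upclosed_powJK n : upclosed (powJ n `&` powK n).
Proof.
move=> m m' [[i [j [l [? ? ?]]]] [e [? ?]]]; split.
  by exists i, j, l; rewrite !mnmDE; split; lia.
by exists e; rewrite !mnmDE; split; lia.
Qed.

Lemma example_ideal_monomial : I = monomial_ideal k (powI 1).
Proof.
apply/seteqP; split.
  apply: smallest_sub; first exact/monomial_ideal_ideal/upclosed_powI.
  move=> _ [[->|->]|->].
  - by rewrite mpolyX_x; apply/monomial_ideal_X/expI1; rewrite !mon3E; apply: Or31.
  - rewrite -[_ * _]mulr1 -(expr0 (z k)) mpolyX_mon3.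
    by apply/monomial_ideal_X/expI1; rewrite !mon3E; apply: Or32.
  - rewrite -[y k ^+ _]mul1r -(expr0 (x k)) -[z k]expr1 mpolyX_mon3.
    by apply/monomial_ideal_X/expI1; rewrite !mon3E; apply: Or33.
have idI : ideal_of [set: _] I by apply: gen_ideal_ideal.
apply: monomial_ideal_sub => // m /expI1 mI.
have sub (g : multinom 3) : (forall v : 'I_3, (g v <= m v)%N) ->
    I (mpolyX k g) -> I (mpolyX k m).
  move=> /mnm_lepP gm; have [_ _ _ IM] := idI.
  by rewrite -(submK gm) mpolyXD; apply: IM.
case: mI => [mI|mI|mI].
- apply: (sub (mon3 (2 * d + 1) 0 0)); last first.
    by rewrite -mpolyX_x; apply: sub_gen_smallest; left; left.
  by move=> v; case: (I3P v) => ->; rewrite !mon3E; lia.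
- apply: (sub (mon3 (2 * d - 1) 2 0)); last first.
    rewrite -mpolyX_mon3 expr0 mulr1.
    by apply: sub_gen_smallest; left; right.
  by move=> v; case: (I3P v) => ->; rewrite !mon3E; lia.
- apply: (sub (mon3 0 (2 * d + 1) 1)); last first.
    by rewrite -mpolyX_mon3 expr0 mul1r; apply: sub_gen_smallest; right.
  by move=> v; case: (I3P v) => ->; rewrite !mon3E; lia.
Qed.

Lemma ideal_pow_monomial n : ideal_pow I n = monomial_ideal k (powI n).
Proof.
elim: n => [|n IHn].
  by apply/seteqP; split => // f _ m _; exists 0%N, 0%N, 0%N; split; lia.
rewrite /ideal_pow iterS -/(ideal_pow I n) IHn {1}example_ideal_monomial.
rewrite monomial_ideal_mul; last exact: upclosed_powI.
congr monomial_ideal; apply/seteqP; split.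
  by move=> _ [m1 Im1 [m2 Im2 <-]]; rewrite /powI/= !mnmDE -add1n; apply: expI_add.
move=> m [i [j [l [ijl ale ble lle]]]].
suff [a [b [c [I1 In [la lb lc]]]]] : exists a b c, [/\ expI d 1 a b c,
    expI d n (m ix - a) (m iy - b) (m iz - c)
    & [/\ (a <= m ix)%N, (b <= m iy)%N & (c <= m iz)%N]].
  exists (mon3 a b c); first by rewrite /powI/= !mon3E.
  exists (mon3 (m ix - a) (m iy - b) (m iz - c)); first by rewrite /powI/= !mon3E.
  by apply/mnmP => v; rewrite mnmDE; case: (I3P v) => ->; rewrite !mon3E subnKC.
(* Split off one copy of a generator that occurs in the representation. *)
have [i0|i0] := posnP i; last first.
  exists (2 * d + 1)%N, 0%N, 0%N; split; first by apply/expI1; apply: Or31.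
    by exists i.-1, j, l; split; nia.
  by split; nia.
have [j0|j0] := posnP j; last first.
  exists (2 * d - 1)%N, 2%N, 0%N; split; first by apply/expI1; apply: Or32.
    by exists i, j.-1, l; split; nia.
  by split; nia.
exists 0%N, (2 * d + 1)%N, 1%N; split; first by apply/expI1; apply: Or33.
  by exists i, j, l.-1; split; nia.
by split; nia.
Qed.

(** * The associated primes and the symbolic powers of I *)

Hypothesis d_gt0 : (0 < d)%N.

(** (x,y) is the annihilator of x^{2d} y modulo I. *)
Lemma Ass_xy : Ass I (var_prime k [pred i : 'I_3 | i != iz]).
Proof.
split; first exact: var_prime_prime.
exists (mpolyX k (mon3 (2 * d) 1 0)).
rewrite example_ideal_monomial; apply/seteqP; split=> [f|f] /=.
  move=> Pf; apply/monomial_ideal_mulX => m /Pf [i iz' mi].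
  apply/expI1; rewrite !mnmDE !mon3E.
  case: (I3P i) iz' mi => -> /= iz' mi; [apply: Or31|apply: Or32|]; try lia.
  by rewrite eqxx in iz'.
move=> /monomial_ideal_mulX If m /If /expI1; rewrite !mnmDE !mon3E => mI.
have [mx|mx] := posnP (m ix).
  exists iy; last by case: mI; lia.
  by rewrite /= -val_eqE /= !inordK.
by exists ix; rewrite //= -val_eqE /= !inordK.
Qed.

(** (x,z) is the annihilator of x^{2d-2} y^{2d+1} modulo I. *)
Lemma Ass_xz : Ass I (var_prime k [pred i : 'I_3 | i != iy]).
Proof.
split; first exact: var_prime_prime.
exists (mpolyX k (mon3 (2 * d - 2) (2 * d + 1) 0)).
rewrite example_ideal_monomial; apply/seteqP; split=> [f|f] /=.
  move=> Pf; apply/monomial_ideal_mulX => m /Pf [i iy' mi].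
  apply/expI1; rewrite !mnmDE !mon3E.
  case: (I3P i) iy' mi => -> /= iy' mi; [apply: Or32| |apply: Or33]; try lia.
  by rewrite eqxx in iy'.
move=> /monomial_ideal_mulX If m /If /expI1; rewrite !mnmDE !mon3E => mI.
have [mx|mx] := posnP (m ix).
  exists iz; last by case: mI; lia.
  by rewrite /= -val_eqE /= !inordK.
by exists ix; rewrite //= -val_eqE /= !inordK.
Qed.

Lemma Ass_misses_y_or_z p : Ass I p -> ~ p (y k) \/ ~ p (z k).
Proof.
move=> [[[_ /negP p1 _] _] [a pE]]; apply/not_andP => -[py pz]; apply: p1.
apply/mem_set; move: py pz; rewrite pE /= mul1r example_ideal_monomial.
rewrite -[y k]expr1 -[z k]expr1 mpolyX_y mpolyX_z ![mpolyX _ _ * a]mulrC.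
move=> /monomial_ideal_mulX Iy /monomial_ideal_mulX Iz m ma.
have /expI1 := Iy m ma; have /expI1 := Iz m ma.
rewrite !mnmDE !mon3E => mz my; apply/expI1.
case: mz my => [?|[? ?]|[? ?]] [?|[? ?]|[? ?]];
  by [apply: Or31; lia | apply: Or32; lia | apply: Or33; lia].
Qed.

(** I^(n) is the intersection of J^n and K^n. *)
Lemma symb_pow_monomial n :
  symb_pow I n = monomial_ideal k (powJ n `&` powK n).
Proof.
apply/seteqP; split=> f; last first.
  rewrite monomial_idealI => -[Jf Kf].
  apply/symb_powP => p Ap; have [pP _] := Ap.
  have idIn s : ideal_of [set: _] [set g : mpoly 3 k | ideal_pow I n (s * g)].
    exact/ideal_of_colon/ideal_pow_ideal.
  have [py|pz] := Ass_misses_y_or_z Ap.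
    exists (y k ^+ ((2 * d + 1) * n)); first exact: prime_notin_exp.
    apply: (monomial_ideal_sub (idIn _)) Kf => m Km /=.
    rewrite mpolyX_y -mpolyXD ideal_pow_monomial; apply/monomial_ideal_X.
    rewrite /powI /= !mnmDE !mon3E.
    by apply: expI_mono (expK_shift d_gt0 Km); lia.
  exists (z k ^+ n); first exact: prime_notin_exp.
  apply: (monomial_ideal_sub (idIn _)) Jf => m Jm /=.
  rewrite mpolyX_z -mpolyXD ideal_pow_monomial; apply/monomial_ideal_X.
  rewrite /powI /= !mnmDE !mon3E.
  by apply: expI_mono (expJ_shift Jm); lia.
move=> /symb_powP fI; rewrite monomial_idealI; split.
  have [s Ps] := fI _ Ass_xy; rewrite ideal_pow_monomial => Isf.
  apply: monomial_ideal_saturated Ps _; last by move=> m /Isf /expI_expJ.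
  move=> m m' le [i [j [l [? ? ?]]]].
  have lex : (m ix <= m' ix)%N by apply: le; rewrite /= -val_eqE /= !inordK.
  have ley : (m iy <= m' iy)%N by apply: le; rewrite /= -val_eqE /= !inordK.
  by exists i, j, l; split; lia.
have [s Ps] := fI _ Ass_xz; rewrite ideal_pow_monomial => Isf.
apply: monomial_ideal_saturated Ps _; last by move=> m /Isf /expI_expK.
move=> m m' le [e [? ?]].
have lex : (m ix <= m' ix)%N by apply: le; rewrite /= -val_eqE /= !inordK.
have lez : (m iz <= m' iz)%N by apply: le; rewrite /= -val_eqE /= !inordK.
by exists e; split; lia.
Qed.

(** * Decomposition of the symbolic powers, and the resurgence *)

Lemma symb_pow_eq_ideal_pow n : (n <= d)%N -> symb_pow I n = ideal_pow I n.
Proof.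
move=> nd; apply/seteqP; split; last exact: ideal_pow_sub_symb_pow.
rewrite symb_pow_monomial ideal_pow_monomial => f JKf m /JKf [Jm Km].
by have [//|[dn _ _ _]] := expJ_expK_split d_gt0 Jm Km; lia.
Qed.

(** The exponent of (x^d y)^{2d+1}. *)
Definition w_mon : multinom 3 := mon3 (d * (2 * d + 1)) (2 * d + 1) 0.

Lemma mpolyX_w_mon : (x k ^+ d * y k) ^+ (2 * d + 1) = mpolyX k w_mon.
Proof. by rewrite exprMn -exprM -mpolyX_mon3 expr0 mulr1. Qed.

Lemma symb_pow_decomposition n : (d < n)%N ->
  symb_pow I n = ideal_add (ideal_pow I n)
    (ideal_scale ((x k ^+ d * y k) ^+ (2 * d + 1)) (ideal_pow I (n - d - 1))).
Proof.
move=> dn; apply/seteqP; split.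
  rewrite symb_pow_monomial mpolyX_w_mon !ideal_pow_monomial.
  have idI j : ideal_of [set: _] (monomial_ideal k (powI j)).
    exact/monomial_ideal_ideal/upclosed_powI.
  apply: monomial_ideal_sub.
    by apply: ideal_add_ideal => //; apply: ideal_scale_ideal.
  move=> m [Jm Km]; have [Im|[_ am bm Im]] := expJ_expK_split d_gt0 Jm Km.
    exists (mpolyX k m); first exact/monomial_ideal_X.
    exists 0; last by rewrite addr0.
    by exists 0; rewrite ?mulr0 //; case: (idI (n - d - 1)%N).
  exists 0; first by case: (idI n).
  exists (mpolyX k m); last by rewrite add0r.
  exists (mpolyX k (mnm_sub m w_mon)).
    by apply/monomial_ideal_X; rewrite /powI /= !mnmBE !mon3E subn0.
  rewrite mulrC -mpolyXD submK //; apply/mnm_lepP => v.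
  by case: (I3P v) => ->; rewrite !mon3E.
have [_ _ SD _] := monomial_ideal_ideal k (@upclosed_powJK n).
move=> _ [f If [_ [g Ig <-]] <-].
rewrite symb_pow_monomial; apply: SD.
  by rewrite -symb_pow_monomial; apply: ideal_pow_sub_symb_pow.
rewrite mpolyX_w_mon mulrC; apply/monomial_ideal_mulX.
move: Ig; rewrite ideal_pow_monomial => Ig m /Ig Im.
rewrite /= /powJ /powK /= !mnmDE !mon3E.
by split; [apply: expI_w_expJ Im|apply: expI_w_expK Im].
Qed.

Lemma symb_pow_sub_ideal_pow n : (0 < n)%N ->
  symb_pow I n `<=` ideal_pow I (n - 1).
Proof.
move=> n0; have [nd|dn] := leqP n d.
  by rewrite symb_pow_eq_ideal_pow //; apply: ideal_pow_anti; lia.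
rewrite symb_pow_decomposition // => _ [f If [_ [g Ig <-]] <-].
have [_ _ ID _] := ideal_pow_ideal I (n - 1); apply: ID.
  by apply: (ideal_pow_anti _ If); lia.
move: Ig; rewrite !ideal_pow_monomial mpolyX_w_mon mulrC => Ig.
apply/monomial_ideal_mulX => m /Ig Im; rewrite /powI /= !mnmDE !mon3E.
have -> : (n - 1 = d + (n - d - 1))%N by lia.
exact: expI_add (expI_w d_gt0) Im.
Qed.

Lemma w_in_symb_pow_not_pow :
  (symb_pow I (d + 1) `\` ideal_pow I (d + 1))
    ((x k ^+ d * y k) ^+ (2 * d + 1)).
Proof.
split.
  rewrite symb_pow_decomposition; last by rewrite addn1.
  have -> : (d + 1 - d - 1 = 0)%N by lia.
  exists 0; first by have [_ I0 _ _] := ideal_pow_ideal I (d + 1).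
  exists ((x k ^+ d * y k) ^+ (2 * d + 1)); last by rewrite add0r.
  by exists 1; rewrite ?mulr1.
rewrite ideal_pow_monomial mpolyX_w_mon => /monomial_ideal_X.
by rewrite /powI /= !mon3E; apply: expI_w_not.
Qed.

Lemma resurgence_example (R : realType) : resurgence R I = 1%:E.
Proof.
apply/eqP; rewrite eq_le; apply/andP; split.
  apply: ge_ereal_sup => _ [m [r [m0 r0 nsub ->]]].
  rewrite lee_fin ler_pdivrMr ?ltr0n // mul1r ler_nat leqNgt.
  apply/negP => rm; apply: nsub.
  apply: subset_trans (symb_pow_sub_ideal_pow m0) _.
  by apply: ideal_pow_anti; lia.
apply: ereal_sup_ubound; exists (d + 1)%N, (d + 1)%N; split; [lia|lia| |].
  by have [wS wI] := w_in_symb_pow_not_pow => /(_ _ wS).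
by rewrite divff // pnatr_eq0 addn1.
Qed.

End ThreeVariables.

Theorem lemma2p6 (R : realType) (k : fieldType) (d : nat) (hd : (1 <= d)%N) :
  [/\ (forall n : nat, (1 <= n <= d)%N ->
         symb_pow (example_ideal k d) n = ideal_pow (example_ideal k d) n),
      (forall n : nat, (d + 1 <= n)%N ->
         symb_pow (example_ideal k d) n
           = ideal_add (ideal_pow (example_ideal k d) n)
               (ideal_scale ((x k ^+ d * y k) ^+ (2 * d + 1))
                  (ideal_pow (example_ideal k d) (n - d - 1)))
         /\ symb_pow (example_ideal k d) n `<=` ideal_pow (example_ideal k d) (n - 1)),
      resurgence R (example_ideal k d) = 1%:E
    & (symb_pow (example_ideal k d) (d + 1) `\` ideal_pow (example_ideal k d) (d + 1))
        ((x k ^+ d * y k) ^+ (2 * d + 1))].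
Proof.
split.
- by move=> n /andP [_ nd]; apply: symb_pow_eq_ideal_pow.
- move=> n; rewrite addn1 => dn; split; first exact: symb_pow_decomposition.
  by apply: symb_pow_sub_ideal_pow => //; apply: leq_trans dn.
- exact: resurgence_example.
- exact: w_in_symb_pow_not_pow.
Qed.
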